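(* Suppose that the set \[ \mathcal M = \left\{ M \geq 0 : \begin{pmatrix} A - M & B^* \\ B & M \end{pmatrix} \geq 0\right\} \] is not empty. Then there exists $\hat A \leq A$ such that the set \[ \hat{\mathcal M} = \left\{ M \geq 0 : \begin{pmatrix} \hat A - M & B^* \\ B & M \end{pmatrix} \geq 0\right\} \] is a singleton.
   Context: $A$ and $B$ are bounded linear operators on a Hilbert space, with $A$ selfadjoint; the block operators act on the direct sum of two copies of that space, and $M$ ranges over positive operators on that space. *)

(* Defs.v *)
(* complex Hilbert spaces set up honestly from an inner product. *)
From HB Require Import structures.
From mathcomp Require Import all_boot all_order all_algebra.
From mathcomp Require Import complex.
From mathcomp Require Import reals.
Set Implicit Arguments. Unset Strict Implicit. Unset Printing Implicit Defensive.
Import Order.TTheory GRing.Theory Num.Theory.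
Local Open Scope ring_scope.

Section Hilbert.
Variables (R : realType) (V : lmodType R[i]) (ip : V -> V -> R[i]).

(* induced norm ||x|| = sqrt (Re <x,x>) *)
Definition ipnorm (x : V) : R := Num.sqrt (complex.Re (ip x x)).

(* complex inner product: linear in the first argument, conjugate symmetric,
   positive definite *)
Definition is_inner_product : Prop :=
  [/\ (forall a x y z, ip (a *: x + y) z = a * ip x z + ip y z),
      (forall x y, ip y x = (ip x y)^*),
      (forall x, 0 <= ip x x) &
      (forall x, ip x x = 0 -> x = 0)].

Definition cauchy_seq (u : nat -> V) : Prop :=
  forall e : R, 0 < e -> exists N, forall m n, (N <= m)%N -> (N <= n)%N ->
    ipnorm (u m - u n) < e.

Definition converges_to (u : nat -> V) (l : V) : Prop :=
  forall e : R, 0 < e -> exists N, forall n, (N <= n)%N -> ipnorm (u n - l) < e.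

(* a Hilbert space: complete inner product space *)
Definition is_hilbert : Prop :=
  is_inner_product /\ forall u, cauchy_seq u -> exists l, converges_to u l.

(* bounded linear operators on V *)
Definition bounded_op (T : V -> V) : Prop :=
  (forall a x y, T (a *: x + y) = a *: T x + T y) /\
  exists c : R, forall x, ipnorm (T x) <= c * ipnorm x.

Definition is_adjoint (T Ts : V -> V) : Prop :=
  forall x y, ip (T x) y = ip x (Ts y).

Definition selfadjoint (T : V -> V) : Prop := is_adjoint T T.

(* T >= 0 *)
Definition positive_op (T : V -> V) : Prop := forall x, 0 <= ip (T x) x.

(* S <= T *)
Definition op_le (S T : V -> V) : Prop := positive_op (fun x => T x - S x).

(* the direct sum V (+) V with inner product <(x1,y1),(x2,y2)> = <x1,x2> + <y1,y2> *)
Definition ip2 (z w : V * V) : R[i] := ip z.1 w.1 + ip z.2 w.2.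

(* the block operator [[P, Q], [S, T]] acting on V (+) V *)
Definition block_op (P Q S T : V -> V) (z : V * V) : V * V :=
  (P z.1 + Q z.2, S z.1 + T z.2).

Definition positive_op2 (T : V * V -> V * V) : Prop := forall z, 0 <= ip2 (T z) z.

(* the set  M(A) = { M >= 0 : [[A - M, B^*],[B, M]] >= 0 } , Bs = B^* *)
Definition Mset (A B Bs : V -> V) (M : V -> V) : Prop :=
  bounded_op M /\ positive_op M /\
  positive_op2 (block_op (fun x => A x - M x) Bs B M).

End Hilbert.

(* Main.v *)
(* Zorn's lemma gives an operator [S <= A] minimal among those for which the
   set of completions is nonempty: along a chain, ultrafilter limits in the weak
   operator topology of the operators and of chosen completions again form an
   admissible pair. For such an [S] and any completion [M], the infimum over [y]
   of the block form at [(x, y)] vanishes for every [x]; otherwise a minimizing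
   sequence produces a nonzero rank one operator that can still be subtracted
   from [S]. Given two completions [M1] and [M2], apply this to their midpoint:
   along some [y_n] both block forms at [(x, y_n)] tend to zero, so by
   Cauchy-Schwarz both [S x - M1 x + Bs y_n] and [S x - M2 x + Bs y_n] tend
   weakly to zero, whence [M1 x = M2 x]. *)
Require Import Defs.
From HB Require Import structures.
From mathcomp Require Import all_boot all_order all_algebra.
From mathcomp Require Import complex.
From mathcomp Require Import boolp classical_sets functions reals.
From mathcomp Require Import interval_inference topology.
From mathcomp Require Import normedtype sequences.
From mathcomp Require Import ring lra.
Import Order.TTheory GRing.Theory Num.Theory.
Import numFieldNormedType.Exports.
Local Open Scope classical_set_scope.
Local Open Scope ring_scope.

(** * Real positive semidefinite forms and their minimizing sequences *)

Lemma discriminant_le (R : realType) (a b c : R) : 0 <= c ->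
  (forall t, 0 <= a + 2 * t * b + t ^+ 2 * c) -> b ^+ 2 <= a * c.
Proof.
move=> c0 H; have [c00|cN0] := eqVneq c 0.
  have [->|bN0] := eqVneq b 0; first by rewrite c00 mulr0 expr0n.
  (* With [c = 0] the expression is affine in [t]; for [b] nonzero this [t] gives it the value
     [-1]. *)
  have := H (- (a + 1) / (2 * b)); rewrite c00.
  have -> : a + 2 * (- (a + 1) / (2 * b)) * b + (- (a + 1) / (2 * b)) ^+ 2 * 0 = -1.
    by field.
  by rewrite oppr_ge0 ler10.
have cp : 0 < c by rewrite lt_def cN0.
have := H (- b / c).
have -> : a + 2 * (- b / c) * b + (- b / c) ^+ 2 * c = (a * c - b ^+ 2) / c by field.
by rewrite pmulr_lge0 ?invr_gt0// subr_ge0.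
Qed.

Section RealForm.
Context {R : realType} {W : lmodType R[i]}.
Implicit Types (b : W -> W -> R) (x y z : W).

(** Linearity over the reals only, on a complex space: order arguments are run on real parts, and
    imaginary parts are recovered through multiplication by [i]. *)
Definition real_linear (g : W -> R) :=
  forall (a : R) x y, g (a%:C%C *: x + y) = a * g x + g y.

Definition real_form b :=
  [/\ forall z, real_linear (b^~ z), forall x y, b x y = b y x
    & forall x, 0 <= b x x].

Section RealLinear.
Context (g : W -> R) (hg : real_linear g).

Lemma real_linearD x y : g (x + y) = g x + g y.
Proof. by have := hg 1 x y; rewrite scale1r mul1r. Qed.

Lemma real_linear0 : g 0 = 0.
Proof. by have := real_linearD 0 0; rewrite addr0; lra. Qed.

Lemma real_linearZ (a : R) x : g (a%:C%C *: x) = a * g x.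
Proof. by have := hg a x 0; rewrite addr0 real_linear0 addr0. Qed.

Lemma real_linearN x : g (- x) = - g x.
Proof. by have := real_linearD x (- x); rewrite subrr real_linear0; lra. Qed.

Lemma real_linearB x y : g (x - y) = g x - g y.
Proof. by rewrite real_linearD real_linearN. Qed.
End RealLinear.

Context (b : W -> W -> R) (hb : real_form b).

Lemma real_form_linearl z : real_linear (b^~ z).
Proof. by case: hb. Qed.

Lemma real_formC x y : b x y = b y x.
Proof. by case: hb. Qed.

Lemma real_form_ge0 x : 0 <= b x x.
Proof. by case: hb. Qed.

Lemma real_form_linearr z : real_linear (b z).
Proof. by move=> a x y; rewrite !(real_formC z); apply: real_form_linearl. Qed.

Let bDl z := real_linearD _ (real_form_linearl z).
Let bZl z := real_linearZ _ (real_form_linearl z).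
Let bNl z := real_linearN _ (real_form_linearl z).
Let bDr z := real_linearD _ (real_form_linearr z).
Let bZr z := real_linearZ _ (real_form_linearr z).
Let bNr z := real_linearN _ (real_form_linearr z).

Lemma real_form_line x y (t : R) :
  b (x + t%:C%C *: y) (x + t%:C%C *: y) = b x x + 2 * t * b x y + t ^+ 2 * b y y.
Proof. by rewrite bDl !bDr bZl !bZr bZl (real_formC y x); ring. Qed.

Lemma real_form_sqrD x y : b (x + y) (x + y) = b x x + 2 * b x y + b y y.
Proof. by rewrite bDl !bDr (real_formC y x); ring. Qed.

Lemma real_form_sqrB x y : b (x - y) (x - y) = b x x - 2 * b x y + b y y.
Proof. by rewrite bDl !bDr bNl !bNr bNl (real_formC y x); ring. Qed.

Lemma real_form_CS x y : b x y ^+ 2 <= b x x * b y y.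
Proof.
apply: discriminant_le => [|t]; first exact: real_form_ge0.
by rewrite -real_form_line real_form_ge0.
Qed.

(* A minimizing sequence of [y |-> b y y - 2 g y]: the parallelogram law makes
   it Cauchy, and perturbing along [w] gives the approximate Euler equation. *)
Lemma minimizing_sequence (g : W -> R) (c : R) : real_linear g ->
  (forall y, c <= b y y - 2 * g y) ->
  exists u : nat -> W,
    [/\ forall n m, b (u n - u m) (u n - u m) <= 2 * (n.+1%:R^-1 + m.+1%:R^-1),
        forall n w, (b (u n) w - g w) ^+ 2 <= n.+1%:R^-1 * b w w
      & exists K, forall n, b (u n) (u n) - 2 * g (u n) <= K].
Proof.
move=> hg hc; pose J y := b y y - 2 * g y.
have infJ : has_inf (range J).
  by split; [exists (J 0), 0|exists c => _ [y _ <-]; exact: hc].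
pose j := inf (range J).
have Jj y : j <= J y by apply: ge_inf; [case: infJ|exists y].
have /choice[u hu] (n : nat) : exists y, J y < j + n.+1%:R^-1.
  have n0 : 0 < n.+1%:R^-1 :> R by rewrite invr_gt0 ltr0n.
  by have [_ [y _ <-] ?] := inf_adherent n0 infJ; exists y.
have gD := real_linearD _ hg; have gZ := real_linearZ _ hg.
exists u; split.
(* [J] is at least [j] at the midpoint and close to [j] at both ends; the parallelogram law then
   bounds the difference. *)
- move=> n m; have := Jj ((2^-1)%:C%C *: (u n + u m)); rewrite /J.
  rewrite bZl bZr gZ gD real_form_sqrD real_form_sqrB.
  have := hu n; have := hu m; rewrite /J.
  move: (n.+1%:R^-1) (m.+1%:R^-1) => d e; lra.
(* As [J (u n)] exceeds [j] by less than [1/(n+1)], the bound [j <= J] along [u n + t w] gives a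
   nonnegative quadratic in [t] with constant term [1/(n+1)]. *)
- move=> n w; apply: discriminant_le => [|t]; first exact: real_form_ge0.
  have := Jj (u n + t%:C%C *: w); have := hu n.
  rewrite /J real_form_line gD gZ; move: (n.+1%:R^-1) => e; lra.
- exists (j + 1) => n; apply: le_trans (ltW (hu n)) _.
  by rewrite lerD2l invf_le1 ?ltr0n// ler1n.
Qed.

End RealForm.

(** * Complex sesquilinear forms and their real parts *)

Section Sesquilinear.
Context {R : realType} {W : lmodType R[i]}.
Implicit Types (f : W -> W -> R[i]) (x y z : W).

Definition op_linear (T : W -> W) :=
  forall (a : R[i]) x y, T (a *: x + y) = a *: T x + T y.

Lemma op_linear0 T : op_linear T -> T 0 = 0.
Proof. by move=> /(_ (-1) 0 0); rewrite !scaleN1r !addNr. Qed.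

Definition sesquilinear f :=
  (forall a x y z, f (a *: x + y) z = a * f x z + f y z) /\
  (forall a x y z, f z (a *: x + y) = a^* * f z x + f z y).

Definition positive_form f := forall x, 0 <= f x x.

Lemma sesquilinear_op f T : op_linear T -> sesquilinear f ->
  sesquilinear (fun x y => f (T x) y).
Proof. by move=> hT [fl fr]; split=> a x y z; rewrite ?hT ?fl// fr. Qed.

Lemma complex_ge0E (z : R[i]) :
  0 <= z -> 0 <= complex.Re z /\ complex.Im z = 0.
Proof. by rewrite lecE /= => /andP[/eqP-> ->]. Qed.

Lemma complex_ge0P (z : R[i]) :
  0 <= complex.Re z -> complex.Im z = 0 -> 0 <= z.
Proof. by rewrite lecE /= => -> ->; rewrite eqxx. Qed.

Section Form.
Context (f : W -> W -> R[i]) (hf : sesquilinear f).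

Lemma sesquilinearDl x y z : f (x + y) z = f x z + f y z.
Proof. by have := hf.1 1 x y z; rewrite scale1r mul1r. Qed.

Lemma sesquilinearDr x y z : f z (x + y) = f z x + f z y.
Proof. by have := hf.2 1 x y z; rewrite scale1r rmorph1 mul1r. Qed.

Lemma sesquilinear0l z : f 0 z = 0.
Proof. by have := sesquilinearDl 0 0 z; rewrite addr0 -[LHS]addr0 => /addrI. Qed.

Lemma sesquilinear0r z : f z 0 = 0.
Proof. by have := sesquilinearDr 0 0 z; rewrite addr0 -[LHS]addr0 => /addrI. Qed.

Lemma sesquilinearZl a x z : f (a *: x) z = a * f x z.
Proof. by have := hf.1 a x 0 z; rewrite sesquilinear0l !addr0. Qed.

Lemma sesquilinearZr a x z : f z (a *: x) = a^* * f z x.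
Proof. by have := hf.2 a x 0 z; rewrite sesquilinear0r !addr0. Qed.

(** Recovers imaginary parts from real parts, so that limits need be taken of real parts only. *)
Lemma Re_sesquilinear_ir x y :
  complex.Re (f x ('i%C *: y)) = complex.Im (f x y).
Proof. by rewrite sesquilinearZr; case: (f x y) => u v /=; rewrite mul0r mulN1r sub0r opprK. Qed.

Lemma Im_sesquilinear_ir x y :
  complex.Im (f x ('i%C *: y)) = - complex.Re (f x y).
Proof. by rewrite sesquilinearZr; case: (f x y) => u v /=; rewrite mul0r mulN1r add0r. Qed.

Lemma Re_sesquilinearZr a x y :
  complex.Re (f x (a^* *: y)) = complex.Re (f (a *: x) y).
Proof. by rewrite sesquilinearZr sesquilinearZl conjCK. Qed.

Lemma Re_sesquilinear_ii x :
  complex.Re (f ('i%C *: x) ('i%C *: x)) = complex.Re (f x x).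
Proof. by rewrite sesquilinearZl sesquilinearZr; case: (f x x) => u v /=; ring. Qed.

Hypothesis fpos : positive_form f.

(** Polarization: the form is real at [x], [y] and [x + y], so the imaginary parts of the two cross
    terms cancel. *)
Lemma positive_form_Im x y : complex.Im (f y x) = - complex.Im (f x y).
Proof.
have [_] := complex_ge0E _ (fpos (x + y)).
have [_] := complex_ge0E _ (fpos x); have [_] := complex_ge0E _ (fpos y).
rewrite sesquilinearDl !sesquilinearDr; case: (f x x) (f x y) (f y x) (f y y) => [? ?][? ?][? ?][? ?] /=.
lra.
Qed.

Lemma positive_form_Re x y : complex.Re (f y x) = complex.Re (f x y).
Proof.
have := positive_form_Im x ('i%C *: y); rewrite Im_sesquilinear_ir sesquilinearZl.
by case: (f x y) (f y x) => [? ?][? ?] /=; lra.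
Qed.

(** Opens Cauchy-Schwarz and minimizing sequences to complex positive forms. *)
Lemma positive_form_real_form : real_form (fun x y => complex.Re (f x y)).
Proof.
split=> [z a x y|x y|x].
- rewrite sesquilinearDl sesquilinearZl; case: (f x z) (f y z) => [? ?][? ?] /=; lra.
- exact: positive_form_Re.
- by case: (complex_ge0E _ (fpos x)).
Qed.
End Form.
End Sesquilinear.

(** * Limits of real families along filters *)

Lemma cvg0_of_sqr_rate (R : realType) (a : nat -> R) (k : R) :
  (forall n, a n ^+ 2 <= n.+1%:R^-1 * k) -> a @ \oo --> 0.
Proof.
move=> ha; apply/cvgr0Pnorm_lt => e e0.
have k0 : 0 <= k.
  by have := le_trans (sqr_ge0 _) (ha 0%N); rewrite invr1 mul1r.
have e2 : 0 < e ^+ 2 / (k + 1) by rewrite divr_gt0 ?exprn_gt0 ?ltr_wpDl.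
have [N _ hN] := near_infty_natSinv_lt (PosNum e2).
exists N => // n /= Nn; rewrite -(ltr_pXn2r (n:=2))// ?nnegrE ?(ltW e0)//.
rewrite real_normK ?num_real//; apply: le_lt_trans (ha n) _.
have := hN n Nn; rewrite /= ltr_pdivlMr ?ltr_wpDl//; apply: le_lt_trans.
by rewrite ler_wpM2l ?invr_ge0// lerDl.
Qed.

Lemma cvgr_unique_ext (R : realType) (I : Type) (U : set_system I) (f g : I -> R)
  (l m : R) : ProperFilter U -> f @ U --> l -> g @ U --> m -> f =1 g -> l = m.
Proof.
by move=> UU + + /funext fg; rewrite fg => /(cvg_lim (@Rhausdorff R)) <-
  /(cvg_lim (@Rhausdorff R)).
Qed.
Arguments cvgr_unique_ext {R I U} [f g l m] {_}.

(** Compactness of [[-c, c]] gives a cluster point, and a cluster point of an ultrafilter is a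
    limit: were the preimage of a neighbourhood not in [U], its complement would be. *)
Lemma ultra_bounded_cvg (R : realType) (I : Type) (U : set_system I) (f : I -> R) (c : R) :
  UltraFilter U -> (forall i, `|f i| <= c) -> cvg (f @ U).
Proof.
move=> UU hc; have UP := @ultra_proper I U UU.
have [|l [_ hl]] := @segment_compact R (- c) c (f @ U) (fmap_proper_filter f UP).
  by apply: (@filterE _ U) => i; rewrite /= in_itv /= -ler_norml.
apply/cvg_ex; exists l => B lB.
have [//|UNB] := in_ultra_setVsetC (f @^-1` B) UU.
by have [y []] := hl (~` B) B UNB lB.
Qed.

(** * Hilbert spaces: Riesz representation and weak operator limits *)

Section Hilbert.
Context {R : realType} {V : lmodType R[i]} {ip : V -> V -> R[i]}.
Implicit Types (x y z : V) (S T : V -> V).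

Local Notation rip x y := (complex.Re (ip x y)).

Section InnerProduct.
Hypothesis hip : is_inner_product ip.

Lemma inner_product_sesquilinear : sesquilinear ip.
Proof.
have [hl hc _ _] := hip; split=> // a x y z.
by rewrite (hc (_ + _)) hl rmorphD rmorphM (hc x) (hc y).
Qed.

Lemma inner_product_positive : positive_form ip.
Proof. by case: hip. Qed.

Lemma inner_product_real_form : real_form (fun x y => rip x y).
Proof.
exact: positive_form_real_form inner_product_sesquilinear inner_product_positive.
Qed.

Let ripl z := real_form_linearl _ inner_product_real_form z.
Let ripr z := real_form_linearr _ inner_product_real_form z.
Let ripC x y := real_formC _ inner_product_real_form x y.
Let rip_ge0 x := real_form_ge0 _ inner_product_real_form x.

Lemma rip_definite x : rip x x = 0 -> x = 0.
Proof.
have [_ _ _ + h] := hip; apply.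
have [_] := complex_ge0E _ (inner_product_positive x).
by case: (ip x x) h => u v /= -> ->.
Qed.

Lemma rip_inj x y : (forall z, rip x z = rip y z) -> x = y.
Proof.
move=> h; apply/eqP; rewrite -subr_eq0; apply/eqP/rip_definite.
by rewrite (real_linearB _ (ripl _)) h subrr.
Qed.

Lemma ipnorm_ge0 x : 0 <= ipnorm ip x.
Proof. exact: sqrtr_ge0. Qed.

Lemma sqr_ipnorm x : ipnorm ip x ^+ 2 = rip x x.
Proof. by rewrite sqr_sqrtr. Qed.

Lemma rip_le_ipnorm x y : `|rip x y| <= ipnorm ip x * ipnorm ip y.
Proof.
rewrite -(ler_pXn2r (n:=2))// ?nnegrE ?mulr_ge0 ?ipnorm_ge0//.
rewrite real_normK ?num_real// exprMn !sqr_ipnorm.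
exact: real_form_CS inner_product_real_form x y.
Qed.

Lemma sqr_bounded_op T (C : R) : op_linear T -> 0 <= C ->
  (forall x, rip (T x) (T x) <= C * rip x x) -> bounded_op ip T.
Proof.
move=> hT C0 hC; split=> //; exists (Num.sqrt C) => x.
by rewrite /ipnorm -sqrtrM// ler_wsqrtr.
Qed.

Lemma bounded_op_form T : bounded_op ip T ->
  exists2 c : R, 0 <= c & forall x, rip (T x) x <= c * rip x x.
Proof.
move=> [_ [c hc]]; exists `|c| => // x.
rewrite -sqr_ipnorm expr2 mulrA (le_trans (ler_norm _))//.
rewrite (le_trans (rip_le_ipnorm _ _))// ler_wpM2r ?ipnorm_ge0//.
by rewrite (le_trans (hc x))// ler_wpM2r ?ipnorm_ge0// ler_norm.
Qed.

Lemma op_sesquilinear T : op_linear T -> sesquilinear (fun x y => ip (T x) y).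
Proof. by move=> hT; apply: sesquilinear_op inner_product_sesquilinear. Qed.

(** Pairing with [z] moves the operator to [S z], where sesquilinearity of [ip] applies. *)
Lemma adjoint_linear S T : is_adjoint ip S T -> op_linear T.
Proof.
move=> hST a x y; apply: rip_inj => z.
have [hl hc _ _] := hip.
have hr u w : ip u (T w) = ip (S u) w by rewrite hST.
rewrite hc hr -hc /=; rewrite [in RHS]hc.
rewrite !inner_product_sesquilinear.2 !hr -!inner_product_sesquilinear.2.
by rewrite -hc.
Qed.

Lemma positive_op_selfadjoint T : op_linear T -> positive_op ip T ->
  selfadjoint ip T.
Proof.
move=> hT Tpos x y; have [_ hc _ _] := hip.
rewrite (hc (T y) x); apply/eqP; rewrite eq_complex.
have hs := op_sesquilinear _ hT.
have := positive_form_Re _ hs Tpos y x; have := positive_form_Im _ hs Tpos y x.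
by case: (ip (T y) x) (ip (T x) y) => ? ? [? ?] /= -> ->; rewrite !eqxx.
Qed.

Lemma converges_to_rip u l x : converges_to ip u l ->
  (fun n => rip x (u n)) @ \oo --> rip x l.
Proof.
move=> hu; apply/cvgrPdist_lt => e e0.
have x0 : 0 < ipnorm ip x + 1 by rewrite ltr_wpDl ?ipnorm_ge0.
have [N hN] := hu (e / (ipnorm ip x + 1)) (divr_gt0 e0 x0).
exists N => // n /= Nn; rewrite -(real_linearB _ (ripr x)).
rewrite (le_lt_trans (rip_le_ipnorm _ _))//.
have := hN _ Nn; rewrite ltr_pdivlMr//; apply: le_lt_trans.
rewrite mulrC ler_pM ?ipnorm_ge0// ?lerDl//.
by rewrite -opprB /ipnorm (real_linearN _ (ripl _)) (real_linearN _ (ripr _)) opprK.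
Qed.

End InnerProduct.

Hypothesis hV : is_hilbert ip.
Let hip : is_inner_product ip := hV.1.
Let hs := inner_product_sesquilinear hip.
Let rf := inner_product_real_form hip.

Lemma cvg_of_rate u (c : R) :
  (forall n m, rip (u n - u m) (u n - u m) <= c * (n.+1%:R^-1 + m.+1%:R^-1)) ->
  exists l, converges_to ip u l.
Proof.
move=> hu; apply: hV.2 => e e0.
have c0 : 0 <= c.
  have := le_trans (real_form_ge0 _ rf _) (hu 0%N 0%N).
  by rewrite pmulr_lge0// addr_gt0 ?invr_gt0 ?ltr0n.
have e2 : 0 < e ^+ 2 / (2 * c + 1) by rewrite divr_gt0 ?exprn_gt0//; lra.
have [N _ hN] := near_infty_natSinv_lt (PosNum e2).
exists N => m n Nm Nn.
rewrite -(ltr_pXn2r (n:=2))// ?nnegrE ?ipnorm_ge0 1?ltW// sqr_ipnorm//.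
apply: le_lt_trans (hu m n) _.
have := hN m Nm; have := hN n Nn; rewrite /= !ltr_pdivlMr; try lra.
have : 0 < n.+1%:R^-1 :> R by rewrite invr_gt0.
have : 0 < m.+1%:R^-1 :> R by rewrite invr_gt0.
move: (n.+1%:R^-1) (m.+1%:R^-1) => a b; lra.
Qed.

(** The representing vector is the limit of a minimizing sequence of [|y|^2 - 2 g y]; the Euler
    equation becomes exact in the limit. *)
Lemma riesz (g : V -> R) (c : R) : real_linear g ->
  (forall x, g x ^+ 2 <= c * rip x x) -> exists u, forall x, g x = rip u x.
Proof.
move=> hg hc.
have [y|u [hu1 hu2 _]] := minimizing_sequence _ rf g (- `|c|) hg.
  (* Otherwise [|y|^2 + |c| < 2 g y], and squaring with [g y ^+ 2 <= c |y|^2] would give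
     [(|c| - |y|^2)^2 < 0]. *)
  rewrite leNgt; apply/negP => h.
  have r0 := real_form_ge0 _ rf y.
  have := hc y; have := ler_norm c; have := normr_ge0 c.
  move: (`|c|) h => d h d0 cd; have := sqr_ge0 (d - rip y y).
  have : c * rip y y <= d * rip y y by rewrite ler_wpM2r.
  have : (rip y y + d) ^+ 2 < (2 * g y) ^+ 2.
    by rewrite ltr_pXn2r ?nnegrE//; lra.
  rewrite !expr2; lra.
have [l hl] := cvg_of_rate u _ hu1.
exists l => x; rewrite (real_formC _ rf).
(* This sequence is constantly [g x]; the bracket tends to zero by the approximate Euler
   equation. *)
have h : (fun n => rip x (u n) - (rip (u n) x - g x)) @ \oo --> rip x l - 0.
  apply: cvgB; first exact: converges_to_rip.
  exact: cvg0_of_sqr_rate (fun n => hu2 n x).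
rewrite -(subr0 (rip x l)); apply: cvgr_unique_ext (cvg_cst (g x)) h _ => n /=.
by rewrite (real_formC _ rf x) subKr.
Qed.

(** The bounded matrix coefficients converge along [U]; for fixed [x] the limit is a bounded
    functional of [y], which Riesz represents by a vector [T x]. *)
Lemma weak_operator_limit (I : Type) (U : set_system I) (T_ : I -> V -> V) (c : R) :
  UltraFilter U -> 0 <= c -> (forall i, op_linear (T_ i)) ->
  (forall i x y, rip (T_ i x) y ^+ 2 <= c * rip x x * rip y y) ->
  exists2 T, bounded_op ip T &
    forall x y, (fun i => rip (T_ i x) y) @ U --> rip (T x) y.
Proof.
move=> UU c0 hT hc; have UP := @ultra_proper I U UU.
pose L x y := lim ((fun i => rip (T_ i x) y) @ U).
have Lcvg x y : (fun i => rip (T_ i x) y) @ U --> L x y.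
  apply: (ultra_bounded_cvg _ _ _ _ (Num.sqrt (c * rip x x * rip y y)) UU) => i.
  by rewrite -sqrtr_sqr ler_wsqrtr.
have Lsqr x y : L x y ^+ 2 <= c * rip x x * rip y y.
  rewrite expr2; apply: cvgr_to_le (cvgM (Lcvg x y) (Lcvg x y)) _.
  by apply: filterE => i; rewrite /= -expr2.
have Llin x : real_linear (L x).
  move=> a y z.
  apply: (cvgr_unique_ext (Lcvg _ _)
    (cvgD (cvgM (cvg_cst a) (Lcvg x y)) (Lcvg x z))) => i /=.
  by rewrite (real_form_linearr _ rf).
have /choice[T LT] x : exists u, forall y, L x y = rip u y.
  exact: riesz _ _ (Llin x) (Lsqr x).
have Tcvg x y : (fun i => rip (T_ i x) y) @ U --> rip (T x) y by rewrite -LT.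
exists T => //; apply: (sqr_bounded_op _ c) => // [a x y|x].
  (* Moving the scalar to the second argument lets complex linearity be tested on real parts. *)
  apply: (rip_inj hip) => z; have E (u v : V) : rip (a *: u + v) z = rip u (a^* *: z) + rip v z.
    rewrite (Re_sesquilinearZr _ hs).
    by rewrite (real_linearD _ (real_form_linearl _ rf z)).
  rewrite E; apply: (cvgr_unique_ext (Tcvg _ _)
    (cvgD (Tcvg x (a^* *: z)) (Tcvg y z))) => i /=.
  by rewrite hT E.
(* At [y = T x] a factor [|T x|^2] cancels, unless it is zero. *)
have := Lsqr x (T x); rewrite !LT => h.
have := real_form_ge0 _ rf (T x).
rewrite le_eqVlt => /predU1P[<-|p].
  by rewrite mulr_ge0// (real_form_ge0 _ rf).
by move: h; rewrite expr2 ler_pM2r.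
Qed.
End Hilbert.

(** * Block operators, order bounds and limits of positive forms *)

Section BlockOperators.
Context {R : realType} {V : lmodType R[i]} {ip : V -> V -> R[i]}.
Hypothesis hV : is_hilbert ip.
Implicit Types (x y : V) (z w : V * V) (S T M : V -> V).

Local Notation rip x y := (complex.Re (ip x y)).

Let hip : is_inner_product ip := hV.1.
Let hs := inner_product_sesquilinear hip.
Let rf := inner_product_real_form hip.

Lemma op_linear_sub S T : op_linear S -> op_linear T ->
  op_linear (fun x => S x - T x).
Proof. by move=> hS hT a x y; rewrite hS hT scalerBr opprD addrACA. Qed.

Lemma block_op_linear (P Q S T : V -> V) : op_linear P -> op_linear Q ->
  op_linear S -> op_linear T -> op_linear (block_op P Q S T).
Proof.
move=> hP hQ hS hT a z w.
by congr (_, _); rewrite /= ?hP ?hQ ?hS ?hT scalerDr addrACA.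
Qed.

Lemma ip2_sesquilinear : sesquilinear (ip2 ip).
Proof.
split=> a z w v; rewrite /ip2 /=; first by rewrite !hs.1 mulrDr addrACA.
by rewrite !hs.2 mulrDr addrACA.
Qed.

(** Cauchy-Schwarz for the form of [S], with both diagonal values bounded through [T]. The constant
    comes from [T] alone, hence is uniform over all such [S]. *)
Lemma positive_op_le_form S T x y (c : R) : op_linear S -> positive_op ip S ->
  op_le ip S T -> 0 <= c -> (forall x, rip (T x) x <= c * rip x x) ->
  rip (S x) y ^+ 2 <= c ^+ 2 * rip x x * rip y y.
Proof.
move=> hS S0 ST c0 hc.
have hSs := op_sesquilinear hip _ hS.
have Sc u : rip (S u) u <= c * rip u u.
  apply: le_trans (hc u); have [+ _] := complex_ge0E _ (ST u).
  by rewrite (real_linearB _ (real_form_linearl _ rf _)) subr_ge0.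
have Sge u : 0 <= rip (S u) u by case: (complex_ge0E _ (S0 u)).
apply: le_trans (real_form_CS _ (positive_form_real_form _ hSs S0) x y) _.
rewrite expr2 -mulrA [c * _ * _]mulrACA -mulrA.
by rewrite [leRHS]mulrA ler_pM.
Qed.

Lemma positive_op_le_bounded S T : op_linear S -> positive_op ip S ->
  op_le ip S T -> bounded_op ip T -> bounded_op ip S.
Proof.
move=> hS S0 ST /(bounded_op_form hip _)[c c0 hc].
apply: (sqr_bounded_op _ (c ^+ 2)) => // [|x]; first exact: sqr_ge0.
have := positive_op_le_form _ _ x (S x) _ hS S0 ST c0 hc.
have := real_form_ge0 _ rf (S x).
rewrite le_eqVlt => /predU1P[<- _|p].
  by rewrite mulr_ge0 ?sqr_ge0// (real_form_ge0 _ rf).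
by rewrite [X in X <= _]expr2 ler_pM2r.
Qed.

Lemma positive_form_limit (I : Type) (U : set_system I) (W : lmodType R[i])
  (f_ : I -> W -> W -> R[i]) (f : W -> W -> R[i]) : ProperFilter U ->
  (forall i, sesquilinear (f_ i)) -> sesquilinear f ->
  (forall x y : W, (fun i => complex.Re (f_ i x y)) @ U --> complex.Re (f x y)) ->
  (\forall i \near U, positive_form (f_ i)) -> positive_form f.
Proof.
move=> UP hf_ hf hlim fpos x; apply: complex_ge0P.
  apply: cvgr_to_ge (hlim x x) _.
  by apply: filterS fpos => i /(_ x) /complex_ge0E[].
(* The imaginary part on the diagonal is the real part at [(x, i x)], so it too is a limit, of
   zeros. *)
rewrite -(Re_sesquilinear_ir _ hf); have h := hlim x ('i%C *: x).
apply/eqP; rewrite eq_le; apply/andP; split;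
  [apply: cvgr_to_le h _|apply: cvgr_to_ge h _]; apply: filterS fpos => i;
  by move=> /(_ x) /complex_ge0E[_ h]; rewrite (Re_sesquilinear_ir _ (hf_ i)) h.
Qed.

(* [u] is the limit of [T1 (x0, y_n)] for a minimizing sequence [y_n] of
   [y |-> Q (x0, y) (x0, y)]; it exists because [T1] is dominated by [Q]. *)
Lemma shorted_vector (Q : V * V -> V * V -> R) (T1 : V * V -> V) (c d : R) x0 :
  real_form Q -> (forall z x, Q z (x, 0) = rip (T1 z) x) ->
  (forall z w, T1 (z - w) = T1 z - T1 w) ->
  0 <= c -> (forall x, Q (x, 0) (x, 0) <= c * rip x x) ->
  0 < d -> (forall y, d <= Q (x0, y) (x0, y)) ->
  exists u, exists2 K, 0 < K &
    d <= rip u x0 /\ forall x y, rip u x ^+ 2 <= K * Q (x, y) (x, y).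
Proof.
move=> hQ QT1 T1B c0 hc d0 hd.
have Qge z := real_form_ge0 _ hQ z.
have pairE x y : (x, y) = (x, 0) + (0, y) :> V * V by congr (_, _); rewrite ?addr0 ?add0r.
have hb : real_form (fun y y' => Q (0, y) (0, y')).
  split=> [y' a y y''|y y'|y]; [|exact: real_formC|exact: Qge].
  rewrite -(real_form_linearl _ hQ (0, y')); congr (Q _ _).
  by congr (_, _); rewrite /= scaler0 addr0.
(* The sign makes [Q (x0, y) (x0, y)], up to a constant, the functional treated by
   [minimizing_sequence]. *)
have hg : real_linear (fun y => - Q (x0, 0) (0, y)).
  move=> a y y'; rewrite mulrN -opprD -(real_form_linearr _ hQ (x0, 0)).
  by congr (- Q _ _); congr (_, _); rewrite /= scaler0 addr0.
have QE y : Q (x0, y) (x0, y) =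
    Q (x0, 0) (x0, 0) + (Q (0, y) (0, y) - 2 * - Q (x0, 0) (0, y)).
  by rewrite pairE (real_form_sqrD _ hQ); ring.
have [y|yn [hy1 hy2 [K0 hK]]] :=
    minimizing_sequence _ hb _ (d - Q (x0, 0) (x0, 0)) hg.
  by rewrite lerBlDl -QE.
pose zn n : V * V := (x0, yn n); pose vn n := T1 (zn n).
have znB n m : Q (zn n - zn m) (zn n - zn m) <= 2 * (n.+1%:R^-1 + m.+1%:R^-1).
  have -> : zn n - zn m = (0, yn n - yn m) by congr (_, _); rewrite /= subrr.
  exact: hy1.
have zn0 (w : V) : (fun n => Q (zn n) (0, w)) @ \oo --> 0.
  apply: (cvg0_of_sqr_rate _ _ (Q (0, w) (0, w))) => n.
  have -> : Q (zn n) (0, w) = Q (0, yn n) (0, w) - - Q (x0, 0) (0, w).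
    by rewrite /zn pairE (real_linearD _ (real_form_linearl _ hQ _)) opprK addrC.
  exact: hy2.
pose K := Q (x0, 0) (x0, 0) + K0.
have hznK n : Q (zn n) (zn n) <= K by rewrite QE lerD2l.
(* Cauchy-Schwarz for [Q] at [z] and [(T1 z, 0)]; one factor [|T1 z|^2] cancels. *)
have T1le z : rip (T1 z) (T1 z) <= c * Q z z.
  have := real_form_CS _ hQ z (T1 z, 0); rewrite QT1.
  have := real_form_ge0 _ rf (T1 z); rewrite le_eqVlt => /predU1P[<- _|p h].
    by rewrite mulr_ge0.
  have := le_trans h (ler_wpM2l (Qge z) (hc (T1 z))).
  by rewrite expr2 mulrCA mulrA ler_pM2r// (mulrC c).
have [|u hu] := cvg_of_rate hV vn (2 * c).
  move=> n m; rewrite /vn -T1B (le_trans (T1le _))// -mulrA mulrCA.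
  by rewrite ler_wpM2l.
(* The component [(x, 0)] contributes [rip x (vn n)]; the component [(0, y)] vanishes in the limit
   by the Euler equation. *)
have hlim x y : (fun n => Q (zn n) (x, y)) @ \oo --> rip x u.
  have : (fun n => rip x (vn n) + Q (zn n) (0, y)) @ \oo --> rip x u + 0.
    by apply: cvgD; [exact: converges_to_rip|exact: zn0].
  rewrite addr0.
  apply: cvg_trans; apply: near_eq_cvg; apply: nearW => n /=.
  rewrite (pairE x y) (real_linearD _ (real_form_linearr _ hQ _)) QT1.
  by rewrite (real_formC _ rf x).
exists u, K; first exact: lt_le_trans (le_trans (hd (yn 0%N)) (hznK 0%N)).
split=> [|x y]; rewrite (real_formC _ rf u); last first.
  rewrite expr2; apply: cvgr_to_le (cvgM (hlim x y) (hlim x y)) _.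
  apply: nearW => n /=; rewrite -expr2.
  by rewrite (le_trans (real_form_CS _ hQ _ _))// ler_wpM2r.
have e0 : (fun n => n.+1%:R^-1 : R) @ \oo --> 0 by exact: cvg_harmonic.
(* By polarization [2 Q (zn n) (zn m)] is at least [2 d - 2 (1/(n+1) + 1/(m+1))]; then [n] tends to
   infinity. *)
have hm m : d - m.+1%:R^-1 <= rip x0 u.
  rewrite -(addr0 (rip x0 u)).
  apply: cvgr_to_ge (cvgD (hlim x0 (yn m)) e0) _.
  apply: nearW => n; rewrite !fctE /=; have := znB n m; rewrite (real_form_sqrB _ hQ).
  have := hd (yn n); have := hd (yn m); rewrite /zn.
  move: (n.+1%:R^-1) (m.+1%:R^-1) => a b; lra.
rewrite -(subr0 d); apply: cvgr_to_le (cvgB (cvg_cst d) e0) _.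
by apply: nearW => m; rewrite !fctE /=; exact: hm.
Qed.
End BlockOperators.

(** * Minimal operators admitting a completion: degeneracy, uniqueness, existence *)

Section MinimalCompletion.
Context {R : realType} {V : lmodType R[i]} {ip : V -> V -> R[i]}.
Hypothesis hV : is_hilbert ip.
Context (B Bs : V -> V) (hB : op_linear B) (hBs : is_adjoint ip B Bs).
Implicit Types (x y : V) (z w : V * V) (S T M : V -> V).

Local Notation rip x y := (complex.Re (ip x y)).
Local Notation blk S M := (block_op (fun x => S x - M x) Bs B M).
Local Notation form S M z w := (ip2 ip (blk S M z) w).

Let hip : is_inner_product ip := hV.1.
Let hs := inner_product_sesquilinear hip.
Let rf := inner_product_real_form hip.
Let hBsl : op_linear Bs := adjoint_linear hip _ _ hBs.

Lemma op_le_trans S T M : op_le ip S T -> op_le ip T M -> op_le ip S M.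
Proof.
move=> ST TM x; rewrite -[M x](subrK (T x)) -addrA (sesquilinearDl _ hs).
exact: addr_ge0 (TM x) (ST x).
Qed.

Lemma completion_sesquilinear S M : op_linear S -> op_linear M ->
  sesquilinear (fun z w => form S M z w).
Proof.
move=> hS hM; apply: sesquilinear_op (ip2_sesquilinear hV).
by apply: block_op_linear => //; apply: op_linear_sub.
Qed.

Lemma completion_formr0 S M z x : form S M z (x, 0) = ip (blk S M z).1 x.
Proof. by rewrite /ip2 /= (sesquilinear0r _ hs) addr0. Qed.

Lemma completion_le S M : op_linear M -> positive_op2 ip (blk S M) ->
  op_le ip M S.
Proof.
move=> hM h x; have := h (x, 0).
by rewrite completion_formr0 /= op_linear0 ?addr0.
Qed.

Lemma Mset_positive S M : Mset ip S B Bs M -> positive_op ip S.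
Proof.
move=> hM x; rewrite -[S x](subrK (M x)) (sesquilinearDl _ hs).
by case: hM => -[hM _] [M0 h]; apply: addr_ge0; [exact: completion_le h x|].
Qed.

Definition minimal_completable S :=
  forall S', op_linear S' -> op_le ip S' S ->
    (exists M, Mset ip S' B Bs M) -> op_le ip S S'.

Lemma minimal_completion_degenerate S M x (d : R) :
  bounded_op ip S -> Mset ip S B Bs M ->
  minimal_completable S ->
  0 < d -> exists y, complex.Re (form S M (x, y) (x, y)) < d.
Proof.
move=> hS hM hmin d0; apply: contrapT => /forallNP hd.
have [[hMl _] [M0 hpos]] := hM; have [hSl _] := hS.
have hform := completion_sesquilinear _ _ hSl hMl.
have [c c0 hc] := bounded_op_form hip _ hS.
have [||||||| u [K K0 [hu huK]]] := shorted_vector hV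
    (fun z w => complex.Re (form S M z w)) (fun z => (blk S M z).1) c d x.
- exact: positive_form_real_form.
- by move=> z y; rewrite completion_formr0.
- move=> z w; rewrite -[in LHS]scaleN1r addrC.
  have -> // := block_op_linear _ _ _ _ (op_linear_sub _ _ hSl hMl) hBsl hB hMl (-1) w z.
  by rewrite /= scaleN1r addrC.
- exact: c0.
- move=> y; rewrite completion_formr0 /= (op_linear0 _ hBsl) addr0.
  rewrite (real_linearB _ (real_form_linearl _ rf y)).
  by have := complex_ge0E _ (M0 y); have := hc y; lra.
- exact: d0.
- by move=> y; rewrite leNgt; apply/negP/hd.
(* The factor 2 is there because [K] controls only the squared real part of [ip u y]; the imaginary
   part, reached through [i y], costs another [K]. *)
pose k : R[i] := ((2 * K)^-1)%:C%C.
pose D y := (k * ip y u) *: u.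
have hD : op_linear D.
  move=> a y y'; rewrite /D hs.1 mulrDr scalerDl scalerA.
  by rewrite mulrCA.
have DE y : ip (D y) y =
    ((2 * K)^-1 * (rip u y ^+ 2 + complex.Im (ip u y) ^+ 2))%:C%C.
  have [_ hc' _ _] := hip; rewrite (sesquilinearZl _ hs) (hc' u y) /k; case: (ip u y) => a b /=.
  by apply/eqP; rewrite eq_complex /=; apply/andP; split; apply/eqP; ring.
have DleS z : complex.Re (ip (D z.1) z.1) <= complex.Re (form S M z z).
  case: z => y y'; rewrite DE /= mulrC ler_pdivrMr ?mulr_gt0//.
  have h1 := huK y y'; have := huK ('i%C *: y) ('i%C *: y').
  have -> : ('i%C *: y, 'i%C *: y') = 'i%C *: (y, y') by [].
  rewrite (Re_sesquilinear_ii _ hform) (Re_sesquilinear_ir _ hs); lra.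
have D0 : positive_op ip D.
  move=> y; rewrite DE; apply: complex_ge0P => //=.
  by rewrite mulr_ge0 ?addr_ge0 ?sqr_ge0// invr_ge0 mulr_ge0// ltW.
have : op_le ip S (fun y => S y - D y).
  apply: hmin; first exact: op_linear_sub.
    by move=> y; rewrite subKr.
  exists M; split; [by case: hM|split=> // z].
  (* [D] changes only the upper left corner, so with the same [M] the form drops by exactly
     [ip (D z.1) z.1], which [DleS] absorbs. *)
  have E : form (fun y => S y - D y) M z z = form S M z z - ip (D z.1) z.1.
    have -> : form (fun y => S y - D y) M z z =
        ip (-1 *: D z.1 + (blk S M z).1) z.1 + ip (blk S M z).2 z.2.
      by rewrite /ip2 /= scaleN1r !addrA (addrC (S z.1)).
    by rewrite hs.1 mulN1r -addrA addrC.
  rewrite E; apply: complex_ge0P.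
    by have := DleS z; case: (form S M z z) (ip (D z.1) z.1) => [? ?][? ?] /=; lra.
  have [_] := complex_ge0E _ (hpos z); have [_] := complex_ge0E _ (D0 z.1).
  by case: (form S M z z) (ip (D z.1) z.1) => [? ?][? ?] /=; lra.
(* Minimality makes [-D] positive, while [ip (D x) x > 0] because [rip u x >= d > 0]. *)
move=> /(_ x); rewrite addrC addKr => /complex_ge0E[+ _].
rewrite (real_linearN _ (real_form_linearl _ rf x)) DE /= oppr_ge0 leNgt.
rewrite mulr_gt0 ?invr_gt0 ?mulr_gt0// ltr_wpDr ?sqr_ge0//.
by rewrite exprn_gt0// (lt_le_trans d0 hu).
Qed.

Lemma minimal_completion_unique S M1 M2 : bounded_op ip S ->
  minimal_completable S ->
  Mset ip S B Bs M1 -> Mset ip S B Bs M2 -> forall x, M1 x = M2 x.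
Proof.
move=> hS hmin hM1 hM2.
have [[hM1l _] [M10 h1]] := hM1; have [[hM2l _] [M20 h2]] := hM2.
have [hSl _] := hS.
pose M x := 2^-1 *: (M1 x + M2 x).
have half (v : V) : 2^-1 *: (v + v) = v.
  rewrite scalerDr -scalerDl -[X in X + _]mul1r -[X in _ + X]mul1r.
  by rewrite -splitr scale1r.
have hMl : op_linear M.
  by move=> a x y; rewrite /M hM1l hM2l addrACA -scalerDr [LHS]scalerDr !scalerA mulrC.
have M0 : positive_op ip M.
  move=> x; rewrite (sesquilinearZl _ hs) (sesquilinearDl _ hs).
  by rewrite mulr_ge0 ?addr_ge0 ?invr_ge0 ?ler0n.
(* The block operator is affine in [M], so the midpoint has the mean of the two forms. *)
have formM z : form S M z z = 2^-1 * (form S M1 z z + form S M2 z z).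
  have -> : blk S M z = 2^-1 *: (blk S M1 z + blk S M2 z).
    congr (_, _) => /=.
      rewrite -{1}(half (S z.1)) -{1}(half (Bs z.2)) -scalerBr -scalerDr.
      rewrite opprD (addrACA (S z.1)); congr (_ *: _); exact: addrACA.
    rewrite -{1}(half (B z.1)) -scalerDr; congr (_ *: _); exact: addrACA.
  by rewrite (sesquilinearZl _ (ip2_sesquilinear hV)) (sesquilinearDl _ (ip2_sesquilinear hV)).
have hM : Mset ip S B Bs M.
  have hpos : positive_op2 ip (blk S M).
    move=> z; rewrite formM; apply: mulr_ge0; first by rewrite invr_ge0 ler0n.
    exact: addr_ge0 (h1 z) (h2 z).
  split; last by split.
  by apply: (positive_op_le_bounded hV _ S) => //; exact: completion_le.
move=> x; apply: (rip_inj hip) => x'.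
have q1 := positive_form_real_form _ (completion_sesquilinear _ _ hSl hM1l) h1.
have q2 := positive_form_real_form _ (completion_sesquilinear _ _ hSl hM2l) h2.
pose N := rip (S x') x'.
have N0 : 0 <= N by case: (complex_ge0E _ (Mset_positive _ _ hM x')).
have hN T : op_linear T -> positive_op ip T ->
    complex.Re (form S T (x', 0) (x', 0)) <= N.
  move=> hT T0; rewrite completion_formr0 /= (op_linear0 _ hBsl) addr0.
  rewrite (real_linearB _ (real_form_linearl _ rf x')).
  by have := complex_ge0E _ (T0 x'); rewrite /N; lra.
(* With [a + b <= e] the sum of the two forms at [(x, y)], the first-row residuals [p], [q] paired
   with [x'] satisfy [p^2 <= a N] and [q^2 <= b N]; then [(p - q)^2 <= 2 p^2 + 2 q^2]. *)
have small e : 0 < e -> (rip (M2 x) x' - rip (M1 x) x') ^+ 2 <= 2 * N * e.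
  move=> e0; have e20 : 0 < e / 2 by rewrite divr_gt0.
  have [y] := minimal_completion_degenerate _ _ x _ hS hM hmin e20.
  rewrite formM; set z := (x, y) => hz.
  have := le_trans (real_form_CS _ q1 z (x', 0))
    (ler_wpM2l (real_form_ge0 _ q1 z) (hN _ hM1l M10)).
  have := le_trans (real_form_CS _ q2 z (x', 0))
    (ler_wpM2l (real_form_ge0 _ q2 z) (hN _ hM2l M20)).
  rewrite !completion_formr0 /=.
  rewrite !(real_linearD _ (real_form_linearl _ rf x')).
  rewrite !(real_linearN _ (real_form_linearl _ rf x')).
  have := real_form_ge0 _ q1 z; have := real_form_ge0 _ q2 z.
  have : complex.Re (form S M1 z z) + complex.Re (form S M2 z z) <= e.
    have half_real : 2^-1 = (2^-1)%:C%C :> R[i] by rewrite fmorphV rmorph_nat.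
    move: hz; rewrite half_real.
    by case: (form S M1 z z) (form S M2 z z) => [? ?][? ?] /=; lra.
  move: (complex.Re (form S M1 z z)) (complex.Re (form S M2 z z)) => a b.
  move: (rip (S x) x') (rip (M1 x) x') (rip (M2 x) x') (rip (Bs y) x') => s m1 m2 r.
  move=> abe b0 a0 hb ha; have abN := ler_wpM2r N0 abe.
  have := sqr_ge0 ((s - m1 + r) + (s - m2 + r)).
  rewrite !expr2 in ha hb *; lra.
apply/eqP; rewrite eq_sym -subr_eq0 -sqrf_eq0 eq_le sqr_ge0 andbT leNgt.
apply/negP => t0; have N1 : 0 < 2 * N + 1 by lra.
(* For the squared difference [t > 0], taking [e = t / (2 N + 1)] gives [t (2 N + 1) <= 2 N t], a
   contradiction. *)
have := small _ (divr_gt0 t0 N1); rewrite mulrA ler_pdivlMr//; move: t0.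
move: (_ ^+ 2) => t t0; rewrite mulrDr mulr1 mulrC; lra.
Qed.

Lemma exists_minimal_completion (A : V -> V) : bounded_op ip A ->
  (exists M, Mset ip A B Bs M) ->
  exists S, [/\ op_linear S, op_le ip S A, exists M, Mset ip S B Bs M &
    minimal_completable S].
Proof.
move=> hA hne; have [hAl _] := hA; have [c c0 hc] := bounded_op_form hip _ hA.
pose T := {S : V -> V | [/\ op_linear S, op_le ip S A & exists M, Mset ip S B Bs M]}.
(* The order is reversed, so that a maximal element for Zorn is minimal for [op_le]. *)
pose Rel (s t : T) := `[< op_le ip (sval t) (sval s) >].
have op_le_refl S : op_le ip S S.
  by move=> x; rewrite subrr (sesquilinear0l _ hs).
have A_in : [/\ op_linear A, op_le ip A A & exists M, Mset ip A B Bs M] by split.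
pose tA : T := exist _ A A_in.
have [|r s t /asboolP rs /asboolP st||[S [hS SA hM]] hmin] := @ZL_preorder T tA Rel.
- by move=> t; apply/asboolP.
- by apply/asboolP; exact: op_le_trans st rs.
(* The empty chain is bounded by [A] itself. *)
- move=> C Ctot; have [[i0 Ci0]|noC] := pselect (exists i, C i); last first.
    by exists tA => s Cs; case: noC; exists s.
  have Relxx t : Rel t t by apply/asboolP.
  (* The filter of tails of the chain, to be refined to an ultrafilter so that bounded coefficients
     converge. *)
  pose F := filter_from C (fun i => [set j | C j /\ Rel i j]).
  have FF : ProperFilter F.
    apply: filter_from_proper; last by move=> i Ci; exists i; split.
    apply: filter_from_filter; first by exists i0.
    move=> i j Ci Cj; have [ij|ji] := Ctot _ _ Ci Cj.
      exists j => // k [Ck jk]; split; split=> //.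
      by apply/asboolP; apply: op_le_trans (asboolW jk) (asboolW ij).
    exists i => // k [Ck ik]; split; split=> //.
    by apply/asboolP; apply: op_le_trans (asboolW ik) (asboolW ji).
  have [U [UU FU]] := ultraFilterLemma FF.
  have UP := @ultra_proper _ U UU.
  have /choice[M_ hM_] (i : T) : exists M, Mset ip (sval i) B Bs M.
    by have [] := svalP i.
  have Tlin (i : T) : op_linear (sval i) by have [] := svalP i.
  have TleA (i : T) : op_le ip (sval i) A by have [] := svalP i.
  have Mlin (i : T) : op_linear (M_ i) by have [[]] := hM_ i.
  have Mpos (i : T) : positive_op ip (M_ i) by have [_ []] := hM_ i.
  have MleA (i : T) : op_le ip (M_ i) A.
    apply: op_le_trans (TleA i); have [_ [_ h]] := hM_ i.
    exact: completion_le h.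
  have [S hS Slim] := weak_operator_limit hV _ U (fun i => sval i) (c ^+ 2) UU
    (sqr_ge0 _) Tlin (fun i x y => positive_op_le_form hV _ _ x y _ (Tlin i)
      (Mset_positive _ _ (hM_ i)) (TleA i) c0 hc).
  have [M hM Mlim] := weak_operator_limit hV _ U M_ (c ^+ 2) UU
    (sqr_ge0 _) Mlin (fun i x y => positive_op_le_form hV _ _ x y _ (Mlin i)
      (Mpos i) (MleA i) c0 hc).
  have [hSl _] := hS; have [hMl _] := hM.
  have SleC s : C s -> op_le ip S (sval s).
    move=> Cs; have hl T' : op_linear T' -> sesquilinear (fun x y => ip (sval s x - T' x) y).
      by move=> hT'; apply: (op_sesquilinear hip); apply: op_linear_sub.
    apply: (positive_form_limit _ _ _ (fun i x y => ip (sval s x - sval i x) y) _ UP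
      (fun i => hl _ (Tlin i)) (hl _ hSl)).
      move=> x y; rewrite (real_linearB _ (real_form_linearl _ rf y)).
      have h : (fun i => rip (sval s x) y - rip (sval i x) y) @ U -->
          rip (sval s x) y - rip (S x) y.
        by apply: cvgB; [exact: cvg_cst|exact: Slim].
      apply: cvg_trans h; apply: near_eq_cvg; apply: filterE => i /=.
      by rewrite (real_linearB _ (real_form_linearl _ rf y)).
    (* The chain members below [s] form a set of [U], so the inequality passes to the limit. *)
    apply: FU; exists s => // i [_ /asboolP]; exact.
  have SA : op_le ip S A by apply: op_le_trans (SleC _ Ci0) (TleA i0).
  have hSM : Mset ip S B Bs M.
    split=> //; split.
      apply: (positive_form_limit _ _ _ (fun i x y => ip (M_ i x) y) _ UP
        (fun i => op_sesquilinear hip _ (Mlin i)) (op_sesquilinear hip _ hMl)) => //.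
      by apply: filterE => i; exact: Mpos.
    apply: (positive_form_limit _ _ _ (fun i z w => form (sval i) (M_ i) z w) _ UP
        (fun i => completion_sesquilinear _ _ (Tlin i) (Mlin i))
        (completion_sesquilinear _ _ hSl hMl)).
      move=> z w.
      (* The real part of the block form is a sum of matrix coefficients, each converging along the
         same [U]. *)
      have E S' M' : complex.Re (form S' M' z w) = rip (S' z.1) w.1 - rip (M' z.1) w.1
          + rip (Bs z.2) w.1 + (rip (B z.1) w.2 + rip (M' z.2) w.2).
        rewrite -(real_linearB _ (real_form_linearl _ rf _)).
        by rewrite -!(real_linearD _ (real_form_linearl _ rf _)) /ip2 /= raddfD.
      have h : (fun i => rip (sval i z.1) w.1 - rip (M_ i z.1) w.1
          + rip (Bs z.2) w.1 + (rip (B z.1) w.2 + rip (M_ i z.2) w.2)) @ U -->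
          complex.Re (form S M z w).
        rewrite E; apply: cvgD; last by apply: cvgD; [exact: cvg_cst|exact: Mlim].
        by apply: cvgD; [apply: cvgB; [exact: Slim|exact: Mlim]|exact: cvg_cst].
      by apply: cvg_trans h; apply: near_eq_cvg; apply: filterE => i /=; rewrite E.
    by apply: filterE => i; have [_ []] := hM_ i.
  have S_in : [/\ op_linear S, op_le ip S A & exists M, Mset ip S B Bs M].
    by split=> //; exists M.
  by exists (exist _ S S_in) => s Cs; apply/asboolP; exact: SleC.
exists S; split=> // S' hS' S'S hM'.
have S'_in : [/\ op_linear S', op_le ip S' A & exists M, Mset ip S' B Bs M].
  by split=> //; exact: (op_le_trans _ _ _ S'S SA).
have /asboolP := hmin (exist _ S' S'_in) (asboolT S'S).
by [].
Qed.

End MinimalCompletion.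

Theorem theorem4p3 (R : realType) (V : lmodType R[i]) (ip : V -> V -> R[i])
  (hV : is_hilbert ip) (A B Bs : V -> V)
  (hA : bounded_op ip A) (hAs : selfadjoint ip A)
  (hB : bounded_op ip B) (hBs : is_adjoint ip B Bs)
  (hne : exists M, Mset ip A B Bs M) :
  exists Ahat : V -> V,
    [/\ bounded_op ip Ahat, selfadjoint ip Ahat, op_le ip Ahat A &
        exists M0, Mset ip Ahat B Bs M0 /\
                   forall M, Mset ip Ahat B Bs M -> M = M0].
Proof.
have [hBl _] := hB.
have [S [hSl SA [M0 hM0] hmin]] := exists_minimal_completion hV B Bs hBl hBs A hA hne.
(* Positivity of [S] gives selfadjointness and, with [S <= A], boundedness. *)
have S0 := Mset_positive hV B Bs hBs _ _ hM0.
have hS := positive_op_le_bounded hV _ _ hSl S0 SA hA.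
exists S; split=> //; first exact: positive_op_selfadjoint hV.1 _ hSl S0.
exists M0; split=> // M hM; apply/funext.
exact: minimal_completion_unique hV B Bs hBl hBs S M M0 hS hmin hM hM0.
Qed.
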